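(* Let $3<\ell\le r/3$ and let $\Gamma$ be a normalized strictly convex $\mathcal C^2$ curve with $\ell(\Gamma)=\ell$ such that the radius of curvature at every point of $\Gamma$ is at least $r$; let $w=w(\Gamma)$. Then for all integers $q\ge1$, $a\ge0$ with $\gcd(a,q)=1$, \[ N(\Gamma)\le 2.04\,q\,\ell\left|w-\frac aq\right|+3.2\,q\,\frac{\ell^2}{r}+2. \]
   Context: A strictly convex $\mathcal C^2$ curve is the image $\Gamma$ of a $\mathcal C^2$ map $\gamma=(x,y):[0,1]\to\mathbb R^2$ such that $x'y''-x''y'$ never vanishes. It is normalized if $0\le y'(0)\le x'(0)$, and then $w(\Gamma)=y'(0)/x'(0)\in[0,1]$. The radius of curvature at $\gamma(t)$ is $(x'^2+y'^2)^{3/2}/|x'y''-x''y'|$; $\ell(\Gamma)$ is the length and $N(\Gamma)=|\Gamma\cap\mathbb Z^2|$. *)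

(* Defs.v *)
From Stdlib Require Import Reals ZArith Lra Ensembles Image Finite_sets.
From Coquelicot Require Import Coquelicot.

Open Scope R_scope.

Definition unit_interval : Ensemble R := fun t => 0 <= t <= 1.

(* [f] is C^2 on [0,1] with first and second derivatives [f'] and [f''].
   Limits are relative to [0,1], hence one-sided at 0 and 1, and the values of
   [f], [f'], [f''] outside [0,1] are irrelevant. *)
Definition is_C2 (f f' f'' : R -> R) : Prop :=
  forall t, unit_interval t ->
    D_in f f' unit_interval t /\
    D_in f' f'' unit_interval t /\
    continue_in f'' unit_interval t.

(* The derivatives are fields, but they are determined on [0,1] by [cx], [cy]. *)
Record strictly_convex_curve : Type := {
  cx : R -> R; cx' : R -> R; cx'' : R -> R;
  cy : R -> R; cy' : R -> R; cy'' : R -> R;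
  cx_C2 : is_C2 cx cx' cx'';
  cy_C2 : is_C2 cy cy' cy'';
  curve_nondegenerate : forall t, unit_interval t ->
    cx' t * cy'' t - cx'' t * cy' t <> 0
}.

Definition curve_image (c : strictly_convex_curve) : Ensemble (R * R) :=
  Image.Im R (R * R) unit_interval (fun t => (cx c t, cy c t)).

Definition normalized (c : strictly_convex_curve) : Prop :=
  0 <= cy' c 0 <= cx' c 0.

(* For a normalized curve [cx' c 0 <> 0]: otherwise [cy' c 0 = 0] as well,
   against [curve_nondegenerate]. *)
Definition initial_slope (c : strictly_convex_curve) : R := cy' c 0 / cx' c 0.

(* The base of [Rpower] is positive on [0,1] by [curve_nondegenerate]. *)
Definition radius_of_curvature (c : strictly_convex_curve) (t : R) : R :=
  Rpower (cx' c t ^ 2 + cy' c t ^ 2) (3 / 2) /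
  Rabs (cx' c t * cy'' c t - cx'' c t * cy' c t).

(* The integrand is continuous on [0,1], so [RInt] is the actual integral. *)
Definition curve_length (c : strictly_convex_curve) : R :=
  RInt (fun t => sqrt (cx' c t ^ 2 + cy' c t ^ 2)) 0 1.

Definition integer_lattice : Ensemble (R * R) :=
  fun p => exists m n : Z, p = (IZR m, IZR n).

Definition lattice_points (c : strictly_convex_curve) : Ensemble (R * R) :=
  Intersection (R * R) (curve_image c) integer_lattice.

(* Main.v *)
(* Count lattice points along the integer-valued form [f = q y - a x].
   The total turning is at most [l / r <= 1/3], so the tangent stays in the right
   half-plane and the slope is a strictly monotone function of the parameter:
   [f'] vanishes at most once, say at [t0], and [f] is injective on both sides of
   [t0]. On each side, the lattice points therefore number at most 1 plus the
   diameter of the range of [f]. Along the curve the unit tangent [(X, Y)] satisfies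
   [|Y - w X| <= 2 l / r], hence [f] is Lipschitz in arc length with constant
   [M = q |w - a/q| + 2 q l / r], and [N <= M l + 2]. *)

Require Import Defs.
From Stdlib Require Import Reals ZArith Lra Lia List Classical Ensembles Image Finite_sets Wf_nat.
From Stdlib Require Import FunctionalExtensionality PropExtensionality.
From Coquelicot Require Import Coquelicot.

Open Scope R_scope.

(** * Counting a set through an injective integer-valued function *)

(** Induction on the list, removing its head from [S]; whether the head lies in [S] is decided
    classically. The list may repeat points or leave [S], hence only an inequality. *)
Lemma cardinal_of_cover (T : Type) (L : list T) (S : Ensemble T) :
  (forall p, S p -> List.In p L) ->
  exists n, cardinal T S n /\ (n <= length L)%nat.
Proof.
  revert S; induction L as [|p L IH]; intros S HS.
  - exists 0%nat; split; [|simpl; lia].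
    assert (E : S = Empty_set T).
    { apply functional_extensionality; intros z;
          apply propositional_extensionality; split; intros Hz.
      - destruct (HS z Hz).
      - destruct Hz. }
    rewrite E; constructor.
  - destruct (IH (fun z => S z /\ z <> p)) as [n [Hn Hle]].
    { intros z [Hz Hne]; destruct (HS z Hz) as [->|]; [now destruct Hne|assumption]. }
    destruct (classic (S p)) as [Hp|Hp].
    + exists (Datatypes.S n); split; [|simpl; lia].
      assert (E : S = Add T (fun z => S z /\ z <> p) p).
      { apply functional_extensionality; intros z;
          apply propositional_extensionality; split; intros Hz.
        - destruct (classic (z = p)) as [->|Hne].
          + right; constructor.
          + left; split; assumption.
        - destruct Hz as [z [Hz _]|z Hz]; [exact Hz|].
          destruct Hz; exact Hp. }
      rewrite E; constructor; [exact Hn|].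
      intros [_ H]; now apply H.
    + exists n; split; [|simpl; lia].
      assert (E : S = (fun z => S z /\ z <> p)).
      { apply functional_extensionality; intros z;
          apply propositional_extensionality; split; intros Hz.
        - split; [exact Hz|]. intros ->; now apply Hp.
        - apply Hz. }
      rewrite E; exact Hn.
Qed.

(** Each of the [n] consecutive integers starting at [k] is the value of at most one point. The
    induction removes the fibre over the last integer. *)
Lemma cover_of_injective_window (T : Type) (phi : T -> R) (k : Z) (n : nat)
  (S : Ensemble T) :
  (forall p p', S p -> S p' -> phi p = phi p' -> p = p') ->
  (forall p, S p -> exists j, (j < n)%nat /\ phi p = IZR (k + Z.of_nat j)) ->
  exists L, (length L <= n)%nat /\ forall p, S p -> List.In p L.
Proof.
  revert S; induction n as [|n IH]; intros S Hinj Hval.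
  - exists nil; split; [simpl; lia|].
    intros p Hp; destruct (Hval p Hp) as [j [Hj _]]; lia.
  - destruct (IH (fun p => S p /\ phi p <> IZR (k + Z.of_nat n))) as [L [HL Hc]].
    { intros p p' [Hp _] [Hp' _]; now apply Hinj. }
    { intros p [Hp Hne]; destruct (Hval p Hp) as [j [Hj Ej]].
      exists j; split; [|exact Ej].
      assert (j <> n) by (intros ->; now apply Hne); lia. }
    destruct (classic (exists p, S p /\ phi p = IZR (k + Z.of_nat n)))
      as [[p0 [Hp0 E0]]|Hno].
    + exists (p0 :: L); split; [simpl; lia|]; intros p Hp.
      destruct (classic (phi p = IZR (k + Z.of_nat n))) as [E|Hne].
      * left; apply Hinj; trivial; congruence.
      * right; apply Hc; now split.
    + exists L; split; [lia|]; intros p Hp; apply Hc; split; [exact Hp|].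
      intros E; apply Hno; now exists p.
Qed.

(** Integers at mutual distance at most [D] lie in a window of [floor D + 1] consecutive integers
    that starts at the least of them. *)
Lemma cover_of_injective_integers (T : Type) (phi : T -> R) (D : R)
  (S : Ensemble T) :
  0 <= D ->
  (forall p, S p -> exists k, phi p = IZR k) ->
  (forall p p', S p -> S p' -> phi p = phi p' -> p = p') ->
  (forall p p', S p -> S p' -> phi p - phi p' <= D) ->
  exists L, INR (length L) <= D + 1 /\ forall p, S p -> List.In p L.
Proof.
  intros HD Hint Hinj Hdiam.
  destruct (classic (exists p, S p)) as [[p0 Hp0]|Hempty].
  2:{ exists nil; split; [simpl; lra|]; intros p Hp; exfalso; apply Hempty; now exists p. }
  destruct (nfloor_ex D HD) as [K [HK1 HK2]].
  assert (Hd : forall p p' k k', S p -> S p' -> phi p = IZR k -> phi p' = IZR k' ->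
            (k - k' <= Z.of_nat K)%Z).
  { intros p p' k k' Hp Hp' E E'.
    specialize (Hdiam p p' Hp Hp'); rewrite E, E', <- minus_IZR in Hdiam.
    assert (IZR (k - k') < IZR (Z.of_nat K + 1)).
    { rewrite plus_IZR, <- INR_IZR_INZ; lra. }
    apply lt_IZR in H; lia. }
  destruct (Hint p0 Hp0) as [k0 E0].
  (* By [Hd] no value is below [k0 - K], so the values are indexed by natural offsets from there and
     well-ordering gives the least one, [m]. Offset [K] is the value at [p0]. *)
  destruct (dec_inh_nat_subset_has_unique_least_element
    (fun j => exists p, S p /\ phi p = IZR (k0 - Z.of_nat K + Z.of_nat j)))
    as [m [[[p1 [Hp1 E1]] Hmin] _]].
  { intros j; apply classic. }
  { exists K, p0; split; [exact Hp0|]; rewrite E0; f_equal; lia. }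
  destruct (cover_of_injective_window T phi (k0 - Z.of_nat K + Z.of_nat m) (K + 1) S)
    as [L [HL Hc]].
  - exact Hinj.
  - intros p Hp; destruct (Hint p Hp) as [k E].
    assert (A1 := Hd p p1 k _ Hp Hp1 E E1).
    assert (A0 := Hd p0 p k0 k Hp0 Hp E0 E).
    assert (A2 := Hmin (Z.to_nat (k - (k0 - Z.of_nat K)))).
    assert (m <= Z.to_nat (k - (k0 - Z.of_nat K)))%nat.
    { apply A2; exists p; split; [exact Hp|]; rewrite E; f_equal; lia. }
    exists (Z.to_nat (k - (k0 - Z.of_nat K + Z.of_nat m))); split; [lia|].
    rewrite E; f_equal; lia.
  - exists L; split; [|exact Hc].
    apply le_INR in HL; rewrite plus_INR in HL; simpl in HL; lra.
Qed.

(** * Extension of functions from [0,1] to the real line *)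

Definition clamp (t : R) : R := Rmax 0 (Rmin 1 t).

Lemma clamp_in (t : R) : unit_interval (clamp t).
Proof.
  unfold unit_interval, clamp, Rmax, Rmin.
  repeat destruct Rle_dec; lra.
Qed.

Lemma clamp_id (t : R) : 0 <= t <= 1 -> clamp t = t.
Proof.
  intros H; unfold clamp, Rmax, Rmin.
  repeat destruct Rle_dec; lra.
Qed.

Lemma clamp_lipschitz (t u : R) : Rabs (clamp u - clamp t) <= Rabs (u - t).
Proof.
  unfold clamp, Rmax, Rmin, Rabs.
  repeat destruct Rle_dec; repeat destruct Rcase_abs; lra.
Qed.

Lemma continuous_clamp (f : R -> R) :
  (forall t, unit_interval t -> continue_in f unit_interval t) ->
  forall t, continuous (fun t => f (clamp t)) t.
Proof.
  intros Hf t; apply continuity_pt_filterlim.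
  intros eps Heps.
  destruct (Hf (clamp t) (clamp_in t) eps Heps) as [d [Hd H]].
  exists d; split; [exact Hd|]; intros u [_ Hu].
  (* [continue_in] is a punctured limit and says nothing when the clamped points coincide, as they
     do beyond an endpoint. *)
  destruct (Req_dec (clamp u) (clamp t)) as [E|Hne].
  { simpl; unfold Rdist; rewrite E, Rminus_diag, Rabs_R0; exact Heps. }
  apply H; split; [split; [apply clamp_in|congruence]|].
  apply Rle_lt_trans with (2 := Hu), clamp_lipschitz.
Qed.

(* Continuity is asked on all of R, so that two-sided mean value theorems apply
   up to the endpoints; functions given on [0,1] are composed with [clamp]. *)
Definition primitive01 (f f' : R -> R) : Prop :=
  (forall t, continuous f t) /\ (forall t, 0 < t < 1 -> is_derive f t (f' t)).

(** Near an interior point [clamp] is the identity, and there the derivative relative to [0,1] is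
    the ordinary one. *)
Lemma primitive01_clamp (f f' : R -> R) :
  (forall t, unit_interval t -> D_in f f' unit_interval t) ->
  primitive01 (fun t => f (clamp t)) (fun t => f' (clamp t)).
Proof.
  intros Hf; split.
  - apply continuous_clamp; intros t Ht.
    apply cont_deriv with (1 := Hf t Ht).
  - intros t Ht; rewrite clamp_id by lra.
    assert (Hloc : locally t (fun u => 0 < u < 1)).
    { apply (filter_and (F := locally t)); [apply (open_gt 0)|apply (open_lt 1)]; lra. }
    apply is_derive_ext_loc with f.
    { apply filter_imp with (2 := Hloc); intros u Hu; now rewrite clamp_id by lra. }
    apply is_derive_Reals; intros eps Heps.
    assert (Ht' : unit_interval t) by (unfold unit_interval; lra).
    destruct (Hf t Ht' eps Heps) as [d [Hd H]].
    (* The bounds [t] and [1 - t] keep [t + h] in [0,1], where the relative derivative can be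
       used. *)
    assert (Hm : 0 < Rmin d (Rmin t (1 - t))) by (repeat apply Rmin_pos; lra).
    exists (mkposreal _ Hm); simpl; intros h Hh0 Hh.
    assert (Hh1 : Rabs h < d) by (eapply Rlt_le_trans; [exact Hh|apply Rmin_l]).
    assert (Hh2 : Rabs h < Rmin t (1 - t)) by (eapply Rlt_le_trans; [exact Hh|apply Rmin_r]).
    assert (Hh3 : Rabs h < t) by (eapply Rlt_le_trans; [exact Hh2|apply Rmin_l]).
    assert (Hh4 : Rabs h < 1 - t) by (eapply Rlt_le_trans; [exact Hh2|apply Rmin_r]).
    apply Rabs_def2 in Hh3; apply Rabs_def2 in Hh4.
    specialize (H (t + h)); simpl in H; unfold Rdist in H.
    replace (t + h - t) with h in H by ring.
    apply H; repeat split; try lra.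
Qed.

(** * Mean value theorems and calculus rules on [0,1] *)

Lemma primitive01_rolle (f f' : R -> R) (a b : R) :
  primitive01 f f' -> 0 <= a -> a < b -> b <= 1 -> f a = f b ->
  exists t, a < t < b /\ f' t = 0.
Proof.
  intros [Hc Hd] Ha Hab Hb E.
  assert (pr : forall t, a < t < b -> derivable_pt f t).
  { intros t Ht; exists (f' t); apply is_derive_Reals, Hd; lra. }
  destruct (Rolle f a b pr) as [t [Ht E0]]; trivial.
  { intros t _; apply continuity_pt_filterlim, Hc. }
  exists t; split; [exact Ht|].
  rewrite <- E0; symmetry; apply derive_pt_eq_0, is_derive_Reals, Hd; lra.
Qed.

Lemma primitive01_monotone (f f' : R -> R) (a b : R) :
  primitive01 f f' -> (forall t, 0 < t < 1 -> 0 <= f' t) ->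
  0 <= a -> a <= b -> b <= 1 -> f a <= f b.
Proof.
  intros [Hc Hd] Hp Ha Hab Hb.
  destruct Hab as [Hab|Hab]; [|rewrite Hab; lra].
  assert (pr : forall t, a < t < b -> derivable_pt f t).
  { intros t Ht; exists (f' t); apply is_derive_Reals, Hd; lra. }
  (* [MVT] is Cauchy's two-function form; with [id] as second function it becomes Lagrange's. *)
  destruct (MVT f id a b pr (fun t _ => derivable_pt_id t)) as [t [Ht E]]; trivial.
  { intros t _; apply continuity_pt_filterlim, Hc. }
  { intros t _; apply derivable_continuous_pt, derivable_pt_id. }
  rewrite derive_pt_id in E; unfold id in E.
  rewrite (derive_pt_eq_0 f t (f' t)) in E by (apply is_derive_Reals, Hd; lra).
  assert (0 <= (b - a) * f' t) by (apply Rmult_le_pos; [|apply Hp]; lra).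
  lra.
Qed.

(** Both [C * g - f] and [C * g + f] are nondecreasing. With [g] the arc length, this turns a bound
    on derivatives into a Lipschitz bound in arc length. *)
Lemma primitive01_dominated (f f' g g' : R -> R) (C a b : R) :
  primitive01 f f' -> primitive01 g g' ->
  (forall t, 0 < t < 1 -> Rabs (f' t) <= C * g' t) ->
  0 <= a -> a <= b -> b <= 1 -> Rabs (f b - f a) <= C * (g b - g a).
Proof.
  intros [Fc Fd] [Gc Gd] H Ha Hab Hb.
  assert (M1 : C * g a - f a <= C * g b - f b).
  { apply (primitive01_monotone (fun t => C * g t - f t) (fun t => C * g' t - f' t)); trivial.
    - split; intros t.
      + apply @continuous_minus with (V := R_NormedModule); [|apply Fc].
        apply @continuous_mult with (K := R_AbsRing); [apply continuous_const|apply Gc].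
      + intros Ht; apply @is_derive_minus with (V := R_NormedModule); [|apply Fd, Ht].
        apply is_derive_scal, Gd, Ht.
    - intros t Ht; specialize (H t Ht); apply Rabs_le_between in H; lra. }
  assert (M2 : C * g a + f a <= C * g b + f b).
  { apply (primitive01_monotone (fun t => C * g t + f t) (fun t => C * g' t + f' t)); trivial.
    - split; intros t.
      + apply @continuous_plus with (V := R_NormedModule); [|apply Fc].
        apply @continuous_mult with (K := R_AbsRing); [apply continuous_const|apply Gc].
      + intros Ht; apply @is_derive_plus with (V := R_NormedModule); [|apply Fd, Ht].
        apply is_derive_scal, Gd, Ht.
    - intros t Ht; specialize (H t Ht); apply Rabs_le_between in H; lra. }
  apply Rabs_le; lra.
Qed.

Lemma primitive01_lincomb (f f' g g' : R -> R) (b c : R) :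
  primitive01 f f' -> primitive01 g g' ->
  primitive01 (fun t => b * f t - c * g t) (fun t => b * f' t - c * g' t).
Proof.
  intros [Fc Fd] [Gc Gd]; split; intros t.
  - apply @continuous_minus with (V := R_NormedModule);
      (apply @continuous_mult with (K := R_AbsRing); [apply continuous_const|]); auto.
  - intros Ht; apply @is_derive_minus with (V := R_NormedModule);
      apply is_derive_scal; auto.
Qed.

Lemma primitive01_div (f f' g g' : R -> R) :
  primitive01 f f' -> primitive01 g g' -> (forall t, g t <> 0) ->
  primitive01 (fun t => f t / g t) (fun t => (f' t * g t - f t * g' t) / g t ^ 2).
Proof.
  intros [Fc Fd] [Gc Gd] Hg; split; intros t.
  - apply continuity_pt_filterlim.
    apply (continuity_pt_div f g t);
      [apply continuity_pt_filterlim, Fc|apply continuity_pt_filterlim, Gc|apply Hg].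
  - intros Ht.
    evar_last; [apply is_derive_div; auto|].
    simpl; unfold minus, plus, opp, mult; simpl; field; apply Hg.
Qed.

(** * Speed, unit tangent and arc length *)

(** The arguments are the components of the velocity, not of the curve; the same holds for
    [arclength]. *)
Definition speed (f g : R -> R) (t : R) : R := sqrt (f t ^ 2 + g t ^ 2).

Lemma primitive01_speed (f f' g g' : R -> R) :
  primitive01 f f' -> primitive01 g g' -> (forall t, 0 < f t ^ 2 + g t ^ 2) ->
  primitive01 (speed f g) (fun t => (f t * f' t + g t * g' t) / speed f g t).
Proof.
  intros [Fc Fd] [Gc Gd] Hp; unfold speed; split; intros t.
  - apply continuity_pt_filterlim.
    apply (continuity_pt_comp (fun t => f t ^ 2 + g t ^ 2) sqrt).
    + assert (Sq : forall h, (forall u, continuous h u) ->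
                continuity_pt (fun u => h u ^ 2) t).
      { intros h Hh; apply (continuity_pt_comp h (fun z => z ^ 2)).
        - apply continuity_pt_filterlim, Hh.
        - apply derivable_continuous_pt, derivable_pt_pow. }
      apply continuity_pt_plus; apply Sq; assumption.
    + apply continuity_pt_sqrt; left; apply Hp.
  - intros Ht.
    assert (Ef := is_derive_unique _ _ _ (Fd t Ht)).
    assert (Eg := is_derive_unique _ _ _ (Gd t Ht)).
    assert (Xf : ex_derive f t) by (eexists; apply Fd, Ht).
    assert (Xg : ex_derive g t) by (eexists; apply Gd, Ht).
    assert (P := Hp t).
    auto_derive.
    + repeat split; trivial; simpl in P; lra.
    + change (Derive (fun u => f u) t) with (Derive f t);
        change (Derive (fun u => g u) t) with (Derive g t); rewrite Ef, Eg.
      replace (f t * (f t * 1) + g t * (g t * 1)) with (f t ^ 2 + g t ^ 2) by ring.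
      field. apply Rgt_not_eq, sqrt_lt_R0, P.
Qed.

Lemma speed_pow2 (f g : R -> R) (t : R) : speed f g t ^ 2 = f t ^ 2 + g t ^ 2.
Proof.
  unfold speed; rewrite <- Rsqr_pow2; apply Rsqr_sqrt.
  assert (A := pow2_ge_0 (f t)); assert (B := pow2_ge_0 (g t)); lra.
Qed.

Lemma Rabs_le_speed_l (f g : R -> R) (t : R) : Rabs (f t) <= speed f g t.
Proof.
  unfold speed; rewrite <- (sqrt_Rsqr_abs (f t)).
  apply sqrt_le_1_alt; rewrite Rsqr_pow2.
  assert (B := pow2_ge_0 (g t)); lra.
Qed.

Lemma Rabs_le_speed_r (f g : R -> R) (t : R) : Rabs (g t) <= speed f g t.
Proof.
  unfold speed; rewrite Rplus_comm; apply (Rabs_le_speed_l g f).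
Qed.

(** This is [(cos theta)' = - theta' sin theta] for the tangent angle [theta], whose derivative is
    [(f g' - f' g) / V^2] with [V] the speed. *)
Lemma primitive01_tangent_l (f f' g g' : R -> R) :
  primitive01 f f' -> primitive01 g g' -> (forall t, 0 < f t ^ 2 + g t ^ 2) ->
  primitive01 (fun t => f t / speed f g t)
    (fun t => - (f t * g' t - f' t * g t) * g t / speed f g t ^ 3).
Proof.
  intros Pf Pg Hp.
  assert (Hs : forall t, 0 < speed f g t) by (intros t; apply sqrt_lt_R0, Hp).
  destruct (primitive01_div _ _ _ _ Pf (primitive01_speed _ _ _ _ Pf Pg Hp)) as [C D].
  { intros t; apply Rgt_not_eq, Hs. }
  split; [exact C|]; intros t Ht; evar_last; [apply D, Ht|].
  simpl; assert (E := speed_pow2 f g t); assert (P := Hs t).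
  (* Once denominators are cleared, the two sides agree modulo the relation [V^2 = f^2 + g^2]. *)
  assert (G : g t ^ 2 = speed f g t ^ 2 - f t ^ 2) by lra.
  field_simplify; try lra.
  f_equal; ring [G].
Qed.

(** Exchanging the two coordinates changes the sign of the determinant, which cancels the minus sign
    of the cosine rule. *)
Lemma primitive01_tangent_r (f f' g g' : R -> R) :
  primitive01 f f' -> primitive01 g g' -> (forall t, 0 < f t ^ 2 + g t ^ 2) ->
  primitive01 (fun t => g t / speed f g t)
    (fun t => (f t * g' t - f' t * g t) * f t / speed f g t ^ 3).
Proof.
  intros Pf Pg Hp.
  assert (Hs : forall t, speed g f t = speed f g t).
  { intros t; unfold speed; now rewrite Rplus_comm. }
  destruct (primitive01_tangent_l g g' f f' Pg Pf) as [C D].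
  { intros t; rewrite Rplus_comm; apply Hp. }
  split; intros t.
  - apply continuous_ext with (2 := C t); intros u; now rewrite Hs.
  - intros Ht; apply is_derive_ext with (f := fun u => g u / speed g f u).
    { intros u; now rewrite Hs. }
    evar_last; [apply D, Ht|]; simpl; rewrite Hs; unfold Rdiv; ring.
Qed.

Definition arclength (f g : R -> R) (t : R) : R := RInt (speed f g) 0 t.

Lemma primitive01_arclength (f g : R -> R) :
  (forall t, continuous (speed f g) t) -> primitive01 (arclength f g) (speed f g).
Proof.
  intros Hc.
  assert (D : forall t, is_derive (arclength f g) t (speed f g t)).
  { intros t; apply is_derive_RInt with 0; [|apply Hc].
    apply filter_forall; intros u; apply (RInt_correct (speed f g)).
    apply @ex_RInt_continuous; intros z _; apply Hc. }
  split; intros t; [|intros _; apply D].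
  apply @ex_derive_continuous; eexists; apply D.
Qed.

Lemma arclength_0 (f g : R -> R) : arclength f g 0 = 0.
Proof. exact (RInt_point 0 (speed f g)). Qed.

Lemma arclength_bounds (f g : R -> R) (t : R) :
  (forall t, continuous (speed f g) t) -> 0 <= t <= 1 ->
  0 <= arclength f g t <= arclength f g 1.
Proof.
  intros Hc Ht.
  assert (P := primitive01_arclength f g Hc).
  rewrite <- (arclength_0 f g) at 1; split;
    apply (primitive01_monotone _ _ _ _ P); try lra; intros u _; apply sqrt_pos.
Qed.

(** * Turning of the tangent under a curvature bound *)

(** For [D] the determinant, [V] the speed and [z] a velocity component, [D * z / V ^ 3] is up to
    sign the derivative of a unit tangent coordinate, and [r * Rabs D <= V ^ 3] says that the
    curvature is at most [1 / r]. As [Rabs z <= V], each tangent coordinate is [1 / r]-Lipschitz in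
    arc length. *)
Lemma curvature_bound (r D V z : R) :
  0 < r -> 0 < V -> r * Rabs D <= V ^ 3 -> Rabs (D * z / V ^ 3) <= Rabs z / r.
Proof.
  intros Hr HV H.
  assert (HV3 : 0 < V ^ 3) by now apply pow_lt.
  unfold Rdiv; rewrite !Rabs_mult, Rabs_inv, (Rabs_pos_eq (V ^ 3)) by lra.
  apply Rmult_le_reg_r with (V ^ 3); [exact HV3|].
  apply Rmult_le_reg_r with r; [exact Hr|].
  replace (Rabs D * Rabs z * / V ^ 3 * V ^ 3 * r) with (r * Rabs D * Rabs z) by (field; lra).
  replace (Rabs z * / r * V ^ 3 * r) with (V ^ 3 * Rabs z) by (field; lra).
  apply Rmult_le_compat_r; [apply Rabs_pos|exact H].
Qed.

Section Turning.

(** In the application [(u, v)] and [(u', v')] are the clamped velocity and acceleration, so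
    pointwise conditions can range over all real [t]. *)
Context (r : R) (u u' v v' : R -> R).
Context (Hr : 0 < r) (Pu : primitive01 u u') (Pv : primitive01 v v').
Context (Hnd : forall t, u t * v' t - u' t * v t <> 0).
Context (Hcurv : forall t, r * Rabs (u t * v' t - u' t * v t) <= speed u v t ^ 3).
Context (H0 : 0 <= v 0 <= u 0) (Hlen : arclength u v 1 <= r / 3).

Let V := speed u v.

Lemma norm2_pos (t : R) : 0 < u t ^ 2 + v t ^ 2.
Proof using Hnd.
  destruct (Req_dec (u t) 0) as [E|E].
  - assert (v t <> 0) by (intros E'; apply (Hnd t); rewrite E, E'; ring).
    assert (A := pow2_gt_0 (v t) H); assert (B := pow2_ge_0 (u t)); lra.
  - assert (A := pow2_gt_0 (u t) E); assert (B := pow2_ge_0 (v t)); lra.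
Qed.

Lemma speed_pos (t : R) : 0 < V t.
Proof using Hnd. apply sqrt_lt_R0, norm2_pos. Qed.

Lemma continuous_speed (t : R) : continuous V t.
Proof using Hnd Pu Pv. apply (primitive01_speed u u' v v' Pu Pv norm2_pos). Qed.

Lemma initial_abscissa_pos : 0 < u 0.
Proof using Hnd H0.
  assert (A := norm2_pos 0).
  destruct (Req_dec (u 0) 0) as [E|E]; [|lra].
  assert (v 0 = 0) by lra. rewrite E, H in A; lra.
Qed.

(* The cosine of the tangent angle starts above 1/3, being at least 1/sqrt 2,
   and loses at most [s / r <= 1/3]. *)
Lemma abscissa_pos (t : R) : 0 <= t <= 1 -> 0 < u t.
Proof using All.
  intros Ht.
  assert (B := primitive01_dominated _ _ _ _ (/ r) 0 t
    (primitive01_tangent_l u u' v v' Pu Pv norm2_pos)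
    (primitive01_arclength u v continuous_speed)).
  assert (S := arclength_bounds u v t continuous_speed Ht).
  rewrite (arclength_0 u v), Rminus_0_r in B.
  assert (U0 := initial_abscissa_pos); assert (V0 := speed_pos 0).
  assert (C : 1 / 3 < u 0 / V 0).
  { apply Rmult_lt_reg_r with (V 0); [exact V0|].
    replace (u 0 / V 0 * V 0) with (u 0) by (field; lra).
    (* From [v 0 <= u 0] one gets [V 0 ^ 2 <= 2 * u 0 ^ 2 < 9 * u 0 ^ 2]. *)
    assert (E := speed_pow2 u v 0); fold V in E; nra. }
  assert (L : / r * arclength u v t <= 1 / 3).
  { apply Rmult_le_reg_l with r; [exact Hr|].
    rewrite <- Rmult_assoc, Rinv_r by lra; lra. }
  assert (X : 0 < u t / V t).
  { assert (B' : Rabs (u t / V t - u 0 / V 0) <= / r * arclength u v t).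
    { apply B; try lra; intros z Hz.
      assert (K := curvature_bound r _ _ (v z) Hr (speed_pos z) (Hcurv z)); fold V.
      replace (- (u z * v' z - u' z * v z) * v z / V z ^ 3)
        with (- ((u z * v' z - u' z * v z) * v z / V z ^ 3)) by (unfold Rdiv; ring).
      rewrite Rabs_Ropp; apply Rle_trans with (1 := K).
      rewrite Rmult_comm; apply Rmult_le_compat_r;
        [left; now apply Rinv_0_lt_compat|apply Rabs_le_speed_r]. }
    apply Rabs_le_between in B'; lra. }
  replace (u t) with (u t / V t * V t) by (field; apply Rgt_not_eq, speed_pos).
  apply Rmult_lt_0_compat; [exact X|apply speed_pos].
Qed.

(** With [(X, Y)] the unit tangent, [Y - w X] vanishes at 0 and is Lipschitz in arc length with
    constant [(1 + w) / r <= 2 / r]. Multiplying by the speed returns from the unit tangent to the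
    velocity. *)
Lemma direction_deviation (t : R) : 0 <= t <= 1 ->
  Rabs (v t - v 0 / u 0 * u t) <= 2 * arclength u v 1 / r * V t.
Proof using All.
  intros Ht; set (w := v 0 / u 0).
  assert (U0 := initial_abscissa_pos).
  assert (W : 0 <= w <= 1).
  { unfold w; split; [apply Rdiv_le_0_compat; lra|].
    apply Rmult_le_reg_r with (u 0); [exact U0|].
    unfold Rdiv; rewrite Rmult_assoc, Rinv_l; lra. }
  assert (B := primitive01_dominated _ _ _ _ (2 / r) 0 t
    (primitive01_lincomb _ _ _ _ 1 w
      (primitive01_tangent_r u u' v v' Pu Pv norm2_pos)
      (primitive01_tangent_l u u' v v' Pu Pv norm2_pos))
    (primitive01_arclength u v continuous_speed)).
  assert (S := arclength_bounds u v t continuous_speed Ht).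
  rewrite (arclength_0 u v), Rminus_0_r in B; fold V in B.
  assert (Vt := speed_pos t); assert (V0 := speed_pos 0).
  assert (B' : Rabs ((v t - w * u t) / V t) <= 2 / r * arclength u v t).
  (* The subtracted term is the value at 0, which is zero by the choice of [w]. *)
  { replace ((v t - w * u t) / V t)
      with (1 * (v t / V t) - w * (u t / V t) - (1 * (v 0 / V 0) - w * (u 0 / V 0)))
      by (unfold w; field; lra).
    apply B; try lra; intros z Hz.
    assert (K1 := curvature_bound r _ _ (u z) Hr (speed_pos z) (Hcurv z)).
    assert (K2 := curvature_bound r _ _ (v z) Hr (speed_pos z) (Hcurv z)).
    assert (M1 := Rabs_le_speed_l u v z); assert (M2 := Rabs_le_speed_r u v z); fold V in M1, M2.
    fold V in K1, K2.
    set (a := (u z * v' z - u' z * v z) * u z / V z ^ 3) in *.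
    set (b := (u z * v' z - u' z * v z) * v z / V z ^ 3) in *.
    replace (1 * a - w * (- (u z * v' z - u' z * v z) * v z / V z ^ 3))
      with (a + w * b) by (unfold b, Rdiv; ring).
    assert (Ri : 0 < / r) by now apply Rinv_0_lt_compat.
    assert (A1 : Rabs a <= / r * V z) by (unfold Rdiv in K1; nra).
    assert (A2 : Rabs b <= / r * V z) by (unfold Rdiv in K2; nra).
    apply Rle_trans with (1 := Rabs_triang _ _).
    rewrite Rabs_mult, (Rabs_pos_eq w) by lra.
    assert (P := Rabs_pos b); unfold Rdiv; nra. }
  unfold Rdiv in B' at 1; rewrite Rabs_mult, Rabs_inv, (Rabs_pos_eq (V t)) in B' by lra.
  apply Rmult_le_compat_r with (r := V t) in B'; [|lra].
  rewrite Rmult_assoc, Rinv_l, Rmult_1_r in B' by lra.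
  apply Rle_trans with (1 := B'), Rmult_le_compat_r; [lra|].
  unfold Rdiv; rewrite (Rmult_assoc 2 (arclength u v 1)), (Rmult_comm (arclength u v 1)),
    <- Rmult_assoc.
  apply Rmult_le_compat_l; [|apply S].
  apply Rmult_le_pos; [lra|left; now apply Rinv_0_lt_compat].
Qed.

(** The form splits into [q (w - a/q) u], the error of the initial slope, and [q (v - w u)], the
    effect of turning. *)
Lemma linear_form_derivative_bound (q a t : R) : 0 < q -> 0 <= t <= 1 ->
  Rabs (q * v t - a * u t) <=
  (q * Rabs (v 0 / u 0 - a / q) + q * (2 * arclength u v 1 / r)) * V t.
Proof using All.
  intros Hq Ht; set (w := v 0 / u 0).
  replace (q * v t - a * u t) with (q * ((w - a / q) * u t) + q * (v t - w * u t))
    by (field; lra).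
  apply Rle_trans with (1 := Rabs_triang _ _).
  rewrite !Rabs_mult, (Rabs_pos_eq q) by lra.
  assert (D := direction_deviation t Ht); fold w in D.
  assert (M := Rabs_le_speed_l u v t); fold V in M.
  rewrite Rmult_plus_distr_r; apply Rplus_le_compat; rewrite Rmult_assoc;
    apply Rmult_le_compat_l; try lra.
  apply Rmult_le_compat_l; [apply Rabs_pos|exact M].
Qed.

(* The slope [v / u] is injective by Rolle, its derivative being
   [(u v' - u' v) / u^2]. *)
Lemma direction_unique (q a t1 t2 : R) :
  (forall t, u t = u (clamp t)) ->
  0 < q -> 0 <= t1 -> t1 < t2 -> t2 <= 1 ->
  q * v t1 - a * u t1 = 0 -> q * v t2 - a * u t2 = 0 -> False.
Proof using All.
  intros Hcl Hq Ht1 Ht Ht2 E1 E2.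
  (* The quotient rule asks for a nonzero denominator on the whole line, and clamping carries
     positivity there from [0,1]. *)
  assert (Up : forall t, 0 < u t) by (intros t; rewrite Hcl; apply abscissa_pos, clamp_in).
  assert (Sl : forall t, q * v t - a * u t = 0 -> v t / u t = a / q).
  { intros t E; assert (U := Up t).
    replace (v t) with (a * u t / q); [field; lra|].
    replace (a * u t) with (q * v t) by lra; field; lra. }
  destruct (primitive01_rolle _ _ t1 t2
    (primitive01_div v v' u u' Pv Pu (fun t => Rgt_not_eq _ _ (Up t))))
    as [t [_ E]]; trivial.
  { now rewrite !Sl. }
  apply (Hnd t).
  apply (Rmult_eq_compat_r (u t ^ 2)) in E.
  unfold Rdiv in E; rewrite Rmult_assoc, Rinv_l in E by (apply Rgt_not_eq, pow_lt, Up).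
  lra.
Qed.

End Turning.

(** * Lattice points on the two arcs where the integer form is injective *)

(** By Rolle [f] is injective on the arc, so distinct points have distinct integer values, and these
    spread over at most [M] times the length. Here [f] is the form [phi] along [gam], and [s] the
    arc length with speed [v]. *)
Lemma cover_of_arc (T : Type) (gam : R -> T) (phi : T -> R) (f f' s v : R -> R)
  (M a b : R) (S : Ensemble T) :
  primitive01 f f' -> primitive01 s v ->
  (forall t, a <= t <= b -> phi (gam t) = f t) ->
  (forall t, 0 < t < 1 -> Rabs (f' t) <= M * v t) ->
  (forall t, a < t < b -> f' t <> 0) ->
  0 <= a -> a <= b -> b <= 1 ->
  (forall p, S p -> exists t, a <= t <= b /\ p = gam t) ->
  (forall p, S p -> exists k, phi p = IZR k) ->
  exists L, INR (length L) <= M * (s b - s a) + 1 /\ forall p, S p -> List.In p L.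
Proof.
  intros Pf Ps Hphi HM Hnz Ha Hab Hb Hgam Hint.
  assert (Dom : forall t t', 0 <= t -> t <= t' -> t' <= 1 ->
            Rabs (f t' - f t) <= M * (s t' - s t)).
  { intros t t'; apply (primitive01_dominated f f' s v); trivial. }
  (* Monotonicity of [M * s] follows from the domination itself, an absolute value being
     nonnegative. *)
  assert (Mon : forall t t', 0 <= t -> t <= t' -> t' <= 1 -> 0 <= M * (s t' - s t)).
  { intros t t' H1 H2 H3; apply Rle_trans with (2 := Dom t t' H1 H2 H3), Rabs_pos. }
  assert (Inj : forall t t', a <= t -> t < t' -> t' <= b -> f t <> f t').
  { intros t t' H1 H2 H3 E.
    destruct (primitive01_rolle f f' t t' Pf) as [z [Hz E']]; try lra.
    apply (Hnz z); lra. }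
  apply (cover_of_injective_integers T phi); trivial.
  - apply Mon; trivial.
  - intros p p' Hp Hp'.
    destruct (Hgam p Hp) as [t [Ht ->]]; destruct (Hgam p' Hp') as [t' [Ht' ->]].
    rewrite !Hphi by trivial; intros E.
    destruct (Rtotal_order t t') as [Hlt|[->|Hlt]]; trivial; exfalso.
    + apply (Inj t t'); trivial; lra.
    + apply (Inj t' t); trivial; try lra; now symmetry.
  - intros p p' Hp Hp'.
    destruct (Hgam p Hp) as [t [Ht ->]]; destruct (Hgam p' Hp') as [t' [Ht' ->]].
    rewrite !Hphi by trivial.
    (* The increment between the two parameters is enlarged to the whole arc by adding the
       nonnegative increments of [M * s] on either side. *)
    destruct (Rle_or_lt t t') as [Hle|Hlt].
    + assert (D := Dom t t'); assert (A := Mon a t); assert (B := Mon t' b).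
      assert (D' := D ltac:(lra) ltac:(lra) ltac:(lra)).
      apply Rabs_le_between in D'.
      assert (A' := A ltac:(lra) ltac:(lra) ltac:(lra)).
      assert (B' := B ltac:(lra) ltac:(lra) ltac:(lra)).
      lra.
    + assert (D := Dom t' t); assert (A := Mon a t'); assert (B := Mon t b).
      assert (D' := D ltac:(lra) ltac:(lra) ltac:(lra)).
      apply Rabs_le_between in D'.
      assert (A' := A ltac:(lra) ltac:(lra) ltac:(lra)).
      assert (B' := B ltac:(lra) ltac:(lra) ltac:(lra)).
      lra.
Qed.

Theorem mainTheorem7 (l r : R) (hl3 : 3 < l) (hlr : l <= r / 3)
  (c : strictly_convex_curve) (hnorm : normalized c)
  (hlen : curve_length c = l)
  (hrad : forall t : R, unit_interval t -> r <= radius_of_curvature c t)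
  (q a : Z) (hq : (1 <= q)%Z) (ha : (0 <= a)%Z) (hqa : Z.gcd a q = 1%Z) :
  exists N : nat,
    cardinal (R * R) (lattice_points c) N /\
    INR N <= 2.04 * IZR q * l * Rabs (initial_slope c - IZR a / IZR q)
             + 3.2 * IZR q * (l ^ 2 / r) + 2.
Proof.
  assert (Hr : 0 < r) by lra.
  pose (u := fun t => cx' c (clamp t)); pose (u' := fun t => cx'' c (clamp t)).
  pose (v := fun t => cy' c (clamp t)); pose (v' := fun t => cy'' c (clamp t)).
  assert (Px : primitive01 (fun t => cx c (clamp t)) u).
  { apply primitive01_clamp; intros t Ht; apply (cx_C2 c t Ht). }
  assert (Py : primitive01 (fun t => cy c (clamp t)) v).
  { apply primitive01_clamp; intros t Ht; apply (cy_C2 c t Ht). }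
  assert (Pu : primitive01 u u').
  { apply primitive01_clamp; intros t Ht; apply (cx_C2 c t Ht). }
  assert (Pv : primitive01 v v').
  { apply primitive01_clamp; intros t Ht; apply (cy_C2 c t Ht). }
  assert (Hnd : forall t, u t * v' t - u' t * v t <> 0).
  { intros t; apply curve_nondegenerate, clamp_in. }
  assert (Hcurv : forall t, r * Rabs (u t * v' t - u' t * v t) <= speed u v t ^ 3).
  { intros t.
    assert (K := hrad (clamp t) (clamp_in t)); unfold radius_of_curvature in K.
    change (r <= Rpower (u t ^ 2 + v t ^ 2) (3 / 2) / Rabs (u t * v' t - u' t * v t)) in K.
    assert (P := norm2_pos u u' v v' Hnd t).
    assert (A := Rabs_pos_lt _ (Hnd t)).
    (* Splitting the exponent turns the real power into [V^2 * V], so the radius condition becomes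
       polynomial in the speed [V]. *)
    replace (3 / 2) with (1 + / 2) in K by lra.
    rewrite Rpower_plus, Rpower_1, Rpower_sqrt in K by exact P.
    apply (Rmult_le_compat_r (Rabs (u t * v' t - u' t * v t))) in K; [|lra].
    unfold Rdiv in K; rewrite (Rmult_assoc _ (/ _)), Rinv_l, Rmult_1_r in K by lra.
    replace (speed u v t ^ 3) with (speed u v t ^ 2 * speed u v t) by ring.
    rewrite speed_pow2; exact K. }
  assert (H0 : 0 <= v 0 <= u 0).
  { unfold u, v; rewrite clamp_id by lra; exact hnorm. }
  assert (Hl : arclength u v 1 = l).
  { rewrite <- hlen; apply RInt_ext; intros t Ht.
    rewrite Rmin_left, Rmax_right in Ht by lra.
    unfold speed, u, v; now rewrite clamp_id by lra. }
  assert (Hl3 : arclength u v 1 <= r / 3) by lra.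
  assert (Hucl : forall t, u t = u (clamp t)).
  { intros t; unfold u; now rewrite (clamp_id (clamp t)) by apply clamp_in. }
  assert (Hq : 0 < IZR q) by (apply IZR_lt; lia).
  set (M := IZR q * Rabs (initial_slope c - IZR a / IZR q) + IZR q * (2 * l / r)).
  assert (HM : forall t, 0 < t < 1 ->
            Rabs (IZR q * v t - IZR a * u t) <= M * speed u v t).
  { intros t Ht.
    replace M with (IZR q * Rabs (v 0 / u 0 - IZR a / IZR q)
                    + IZR q * (2 * arclength u v 1 / r)).
    - apply (linear_form_derivative_bound r u u' v v'); trivial; lra.
    - rewrite Hl; unfold M, initial_slope, u, v; now rewrite clamp_id by lra. }
  (* The tangent is parallel to [(q, a)] at most once, and the curve is cut there. *)
  assert (Split : exists t0, 0 <= t0 <= 1 /\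
            (forall t, 0 < t < t0 -> IZR q * v t - IZR a * u t <> 0) /\
            (forall t, t0 < t < 1 -> IZR q * v t - IZR a * u t <> 0)).
  { assert (Uniq : forall t1 t2, 0 <= t1 -> t1 < t2 -> t2 <= 1 ->
      IZR q * v t1 - IZR a * u t1 = 0 -> IZR q * v t2 - IZR a * u t2 = 0 -> False).
    { intros t1 t2; apply (direction_unique r u u' v v'); trivial. }
    destruct (classic (exists t, 0 <= t <= 1 /\ IZR q * v t - IZR a * u t = 0))
      as [[t0 [Ht0 E0]]|Hno].
    - exists t0; split; [exact Ht0|split]; intros t Ht E.
      + apply (Uniq t t0); trivial; lra.
      + apply (Uniq t0 t); trivial; lra.
    (* With no such tangent the cut is put at 0, and the first arc reduces to the starting point. *)
    - exists 0; split; [lra|split]; intros t Ht E; [lra|].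
      apply Hno; exists t; split; [lra|exact E]. }
  destruct Split as [t0 [Ht0 [Nz1 Nz2]]].
  pose (gam := fun t => (cx c t, cy c t)).
  pose (phi := fun p : R * R => IZR q * snd p - IZR a * fst p).
  pose (f := fun t => IZR q * cy c (clamp t) - IZR a * cx c (clamp t)).
  assert (Pf : primitive01 f (fun t => IZR q * v t - IZR a * u t)).
  { apply (primitive01_lincomb (fun t => cy c (clamp t)) v (fun t => cx c (clamp t)) u); trivial. }
  assert (Ps := primitive01_arclength u v (continuous_speed u u' v v' Pu Pv Hnd)).
  (* Both closed pieces contain the cut point, which may be listed twice; an upper bound allows
     this. *)
  pose (piece := fun b d p => lattice_points c p /\ exists t, b <= t <= d /\ p = gam t).
  assert (Cover : forall b d, 0 <= b -> b <= d -> d <= 1 ->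
    (forall t, b < t < d -> IZR q * v t - IZR a * u t <> 0) ->
    exists L, INR (length L) <= M * (arclength u v d - arclength u v b) + 1 /\
      forall p, piece b d p -> List.In p L).
  { intros b d Hb Hbd Hd Nz.
    apply (cover_of_arc (R * R) gam phi f (fun t => IZR q * v t - IZR a * u t) _ (speed u v));
      trivial.
    - intros t Ht; unfold phi, gam, f; simpl; now rewrite clamp_id by lra.
    - intros p [_ Hp]; exact Hp.
    - intros p [Hp _]; destruct Hp as [p _ [m [n ->]]].
      exists (q * n - a * m)%Z; unfold phi; simpl.
      now rewrite minus_IZR, !mult_IZR. }
  destruct (Cover 0 t0) as [L1 [HL1 C1]]; try lra; trivial.
  destruct (Cover t0 1) as [L2 [HL2 C2]]; try lra; trivial.
  destruct (cardinal_of_cover (R * R) (L1 ++ L2) (lattice_points c)) as [N [HN HNL]].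
  { intros p Hp; apply in_or_app.
    assert (Hi : curve_image c p) by (destruct Hp; assumption).
    destruct Hi as [t Ht p Ep]; red in Ht; unfold unit_interval in Ht.
    destruct (Rle_or_lt t t0) as [Hle|Hlt].
    - left; apply C1; split; [exact Hp|exists t; split; [lra|exact Ep]].
    - right; apply C2; split; [exact Hp|exists t; split; [lra|exact Ep]]. }
  exists N; split; [exact HN|].
  apply le_INR in HNL; rewrite length_app, plus_INR in HNL.
  rewrite (arclength_0 u v) in HL1; rewrite Hl in HL2.
  (* The two lengths add up to [l], so the count is at most [M * l + 2]. This has coefficients 1 and
     2, below 2.04 and 3.2, and both terms are nonnegative. *)
  assert (E : M * l = 1 * (IZR q * l * Rabs (initial_slope c - IZR a / IZR q))
                      + 2 * (IZR q * (l ^ 2 / r))) by (unfold M; field; lra).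
  assert (A1 : 0 <= IZR q * l * Rabs (initial_slope c - IZR a / IZR q)).
  { apply Rmult_le_pos; [apply Rmult_le_pos; lra|apply Rabs_pos]. }
  assert (A2 : 0 <= IZR q * (l ^ 2 / r)).
  { apply Rmult_le_pos; [lra|]; apply Rdiv_le_0_compat; [apply pow2_ge_0|exact Hr]. }
  lra.
Qed.
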